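(* Let $k\ge2$ be an integer, let $P\in\mathscr{A}$ be a self-adjoint projection with $\tau(P)=1/k$ which is free from $\{U_t,U_t^{\star}\}_{t\ge0}$, let $J_t = PU_tPU_t^{\star}P$ and $T_k = kP-{\bf 1}$. Set $$M_{t,k}(z) := k\sum_{n\ge0}\tau(J_t^n)z^n,\qquad \rho_{t,k}(z) := \sum_{n\ge1}\tau[(T_kU_tT_kU_t^{\star})^n]\frac{z^n}{(k-1)^n}.$$ Then for any $t>0$ and all $z$ in a neighborhood of the origin, $$M_{t,k}(z) = M_{\infty,k}(z) + \frac{k^2}{\sqrt{k^2-4(k-1)z}}\;\rho_{t,k}\left(\alpha\left[\frac{4(k-1)z}{k^2}\right]\right),$$ where $$M_{\infty,k}(z) := \sum_{n\ge0}m_n(\infty)z^n = \frac{2-k+\sqrt{k^2-4(k-1)z}}{2(1-z)},\quad |z|<1,$$ is the moment generating function of $J_{\infty} = PU_{\infty}PU_{\infty}^{\star}P$ in $(P\mathscr{A}P,k\tau)$ and $$\alpha(z) = \frac{1-\sqrt{1-z}}{1+\sqrt{1-z}},\quad z\in\mathbb{C}\setminus[1,\infty[.$$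
   Context: $(\mathscr{A},\tau)$ is a tracial non commutative probability space (a von Neumann algebra with faithful normal tracial state $\tau$). $(U_t)_{t\ge 0}$ is a free unitary Brownian motion in $\mathscr{A}$, i.e. the solution of the free stochastic differential equation $dU_t = iU_t\,dX_t - \frac{1}{2}U_t\,dt$, $U_0 = {\bf 1}$, where $(X_t)_{t \ge 0}$ is a free additive Brownian motion. $U_{\infty}\in\mathscr{A}$ is a Haar unitary operator free from $P$, and $m_n(\infty)$ is the $n$-th moment of $J_\infty$ in $(P\mathscr{A}P,k\tau)$. In the compressed algebra $P\mathscr{A}P$ the unit is $P$, so $J_t^0=P$ and the $n=0$ term of $M_{t,k}$ equals $1$. Square roots are principal determinations. *)

(* Defs.v *)
From HB Require Import structures.
From mathcomp Require Import all_boot all_order all_algebra.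
From mathcomp Require Export complex.
From mathcomp Require Export all_classical all_reals all_analysis.
Set Implicit Arguments.
Unset Strict Implicit.
Unset Printing Implicit Defensive.
Import Order.TTheory GRing.Theory Num.Theory numFieldNormedType.Exports.
Local Open Scope classical_set_scope.
Local Open Scope complex_scope.
Local Open Scope ring_scope.

Definition inner_product (R : realType) (H : normedModType R[i])
    (ip : H -> H -> R[i]) : Prop :=
  [/\ forall (c : R[i]) x y z, ip (c *: x + y) z = c * ip x z + ip y z,
      forall x y, ip y x = (ip x y)^* &
      forall x, ip x x = `|x| ^+ 2].

Definition bounded_operator (R : realType) (H : normedModType R[i])
    (T : H -> H) : Prop :=
  linear T /\ continuous T.

(* T belongs to the bicommutant, in B(H), of the set S of operators on H. *)
Definition bicommutant (R : realType) (H : normedModType R[i])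
    (S : set (H -> H)) (T : H -> H) : Prop :=
  bounded_operator T /\
  forall V : H -> H, bounded_operator V ->
    (forall W, S W -> V \o W = W \o V) -> V \o T = T \o V.

(* A von Neumann algebra is presented as a unital complex algebra vn_alg that  *)
(* vn_rep identifies with a unital *-subalgebra of B(H), H a Hilbert space,    *)
(* equal to its own bicommutant.  As vn_rep is injective, the usual algebraic  *)
(* laws of the involution vn_star follow from vn_rep_star.                     *)
Record vonNeumannAlgebra (R : realType) := VonNeumannAlgebra {
  vn_alg :> algType R[i] ;
  vn_star : vn_alg -> vn_alg ;
  vn_H : completeNormedModType R[i] ;
  vn_ip : vn_H -> vn_H -> R[i] ;
  vn_ipP : inner_product vn_ip ;
  vn_rep : vn_alg -> vn_H -> vn_H ;
  vn_rep_bounded : forall a, bounded_operator (vn_rep a) ;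
  vn_rep_linear : forall (c : R[i]) a b h,
    vn_rep (c *: a + b) h = c *: vn_rep a h + vn_rep b h ;
  vn_rep_mul : forall a b h, vn_rep (a * b) h = vn_rep a (vn_rep b h) ;
  vn_rep_one : forall h, vn_rep 1 h = h ;
  vn_rep_star : forall a h g,
    vn_ip (vn_rep a h) g = vn_ip h (vn_rep (vn_star a) g) ;
  vn_rep_inj : injective vn_rep ;
  vn_rep_bicommutant : forall T,
    bicommutant (range vn_rep) T -> range vn_rep T
}.

(* a <= b iff b - a is positive *)
Definition vn_le (R : realType) (A : vonNeumannAlgebra R) (a b : A) : Prop :=
  exists c : A, b - a = vn_star c * c.

Definition vn_sup (R : realType) (A : vonNeumannAlgebra R) (D : set A) (x : A) :
    Prop :=
  (forall d, D d -> vn_le d x) /\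
  (forall y, (forall d, D d -> vn_le d y) -> vn_le x y).

Definition normal_functional (R : realType) (A : vonNeumannAlgebra R)
    (tau : A -> R[i]) : Prop :=
  forall (D : set A) (x : A),
    D !=set0 ->
    (forall d, D d -> vn_star d = d) ->
    (forall d e, D d -> D e -> exists f, [/\ D f, vn_le d f & vn_le e f]) ->
    vn_sup D x ->
    forall eps : R, 0 < eps -> exists2 d, D d & tau x - eps%:C < tau d.

(* tracial non-commutative probability space *)
Record tracialNCPS (R : realType) := TracialNCPS {
  nc_vn :> vonNeumannAlgebra R ;
  nc_tau : {scalar nc_vn} ;
  nc_tau_one : nc_tau 1 = 1 ;
  nc_tau_pos : forall a, 0 <= nc_tau (vn_star a * a) ;
  nc_tau_faithful : forall a, nc_tau (vn_star a * a) = 0 -> a = 0 ;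
  nc_tau_trace : forall a b, nc_tau (a * b) = nc_tau (b * a) ;
  nc_tau_normal : normal_functional nc_tau
}.

(* the operator norm of a is at most c *)
Definition opnorm_le (R : realType) (A : vonNeumannAlgebra R) (a : A) (c : R) :
    Prop :=
  forall h, `|vn_rep a h| <= c%:C * `|h|.

(* the unital *-subalgebra generated by S *)
Inductive star_alg (R : realType) (A : vonNeumannAlgebra R) (S : set A) :
    A -> Prop :=
| star_alg_in a : S a -> star_alg S a
| star_alg_one : star_alg S 1
| star_alg_add a b : star_alg S a -> star_alg S b -> star_alg S (a + b)
| star_alg_scale (c : R[i]) a : star_alg S a -> star_alg S (c *: a)
| star_alg_mul a b : star_alg S a -> star_alg S b -> star_alg S (a * b)
| star_alg_star a : star_alg S a -> star_alg S (vn_star a).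

(* the von Neumann subalgebra generated by S *)
Definition vn_gen (R : realType) (A : vonNeumannAlgebra R) (S : set A) : set A :=
  [set a | bicommutant (@vn_rep R A @` (S `|` @vn_star R A @` S)) (vn_rep a)].

(* A family of sets is free when the *-algebras they generate are: alternating *)
(* products of centered elements are centered.                                 *)
Definition free_family (R : realType) (A : tracialNCPS R) (I : eqType)
    (S : I -> set A) : Prop :=
  forall (n : nat) (i : nat -> I) (a : nat -> A),
    (0 < n)%N ->
    (forall j, (j < n)%N -> star_alg (S (i j)) (a j) /\ nc_tau A (a j) = 0) ->
    (forall j, (j.+1 < n)%N -> i j != i j.+1) ->
    nc_tau A (\prod_(0 <= j < n) a j) = 0.

Definition free_pair (R : realType) (A : tracialNCPS R) (S T : set A) : Prop :=
  free_family (fun b : bool => if b then S else T).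

Definition vn_unitary (R : realType) (A : vonNeumannAlgebra R) (u : A) : Prop :=
  vn_star u * u = 1 /\ u * vn_star u = 1.

Definition haar_unitary (R : realType) (A : tracialNCPS R) (u : A) : Prop :=
  vn_unitary u /\
  forall n, (0 < n)%N ->
    nc_tau A (u ^+ n) = 0 /\ nc_tau A (vn_star u ^+ n) = 0.

(* centered semicircular element of variance v > 0, through its moments *)
Definition semicircular (R : realType) (A : tracialNCPS R) (v : R) (x : A) :
    Prop :=
  vn_star x = x /\
  forall n : nat, nc_tau A (x ^+ n) =
    (\int[lebesgue_measure]_(y in `[- (2 * Num.sqrt v), 2 * Num.sqrt v])
       (y ^+ n * (Num.sqrt (4 * v - y ^+ 2) / (2 * pi * v))))%:C.

(* Processes are functions on R whose values at negative times are irrelevant. *)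
Definition free_additive_BM (R : realType) (A : tracialNCPS R) (X : R -> A) :
    Prop :=
  [/\ X 0 = 0,
      forall s t, 0 <= s -> s < t -> semicircular (t - s) (X t - X s) &
      forall (n : nat) (t : nat -> R), 0 <= t 0%N ->
        (forall j, (j < n)%N -> t j <= t j.+1) ->
        free_family (fun j : 'I_n => [set X (t j.+1) - X (t j)])].

Definition adapted (R : realType) (A : vonNeumannAlgebra R) (X Y : R -> A) :
    Prop :=
  forall t, 0 <= t ->
    vn_gen [set a | exists s, [/\ 0 <= s, s <= t & a = X s]] (Y t).

Definition norm_continuous (R : realType) (A : vonNeumannAlgebra R)
    (Y : R -> A) : Prop :=
  forall t, 0 <= t -> forall eps, 0 < eps -> exists2 delta, 0 < delta &
    forall s, 0 <= s -> `|s - t| < delta -> opnorm_le (Y s - Y t) eps.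

(* Z-integral of Y over [0, t]: operator-norm limit of the left-endpoint sums  *)
(* as the mesh of the partition tends to 0.  For Y adapted and norm-continuous *)
(* and Z a free Brownian motion this is the free Ito integral of Y_s dZ_s.     *)
Definition is_left_integral (R : realType) (A : vonNeumannAlgebra R)
    (Y Z : R -> A) (t : R) (I : A) : Prop :=
  forall eps, 0 < eps -> exists2 delta, 0 < delta &
    forall (n : nat) (s : nat -> R), s 0%N = 0 -> s n = t ->
      (forall j, (j < n)%N -> s j <= s j.+1 /\ s j.+1 - s j < delta) ->
      opnorm_le (\sum_(j < n) Y (s j) * (Z (s j.+1) - Z (s j)) - I) eps.

(* unitary solution of dU_t = i U_t dX_t - U_t dt / 2, U_0 = 1 *)
Definition free_unitary_BM (R : realType) (A : tracialNCPS R) (U : R -> A) :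
    Prop :=
  exists X : R -> A,
    [/\ free_additive_BM X,
        forall t, 0 <= t -> vn_unitary (U t),
        norm_continuous U /\ adapted X U,
        U 0 = 1 &
        forall t, 0 <= t -> exists I J : A,
          [/\ is_left_integral U X t I,
              is_left_integral U (fun s => s%:C%:A) t J &
              U t = 1 + 'i%C *: I - 2^-1 *: J]].

(* PuPu*P *)
Definition compressed_jacobi (R : realType) (A : vonNeumannAlgebra R)
    (P u : A) : A :=
  P * u * P * vn_star u * P.

(* n-th power of J in the compressed algebra PAP, whose unit is P *)
Definition compressed_pow (R : realType) (A : vonNeumannAlgebra R)
    (P J : A) (n : nat) : A :=
  iter n ( *%R J) P.

Definition proj_T (R : realType) (A : vonNeumannAlgebra R) (k : nat) (P : A) :
    A :=
  k%:R * P - 1.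

Definition power_sums (K : numFieldType) (a : nat -> K) (z : K) : nat -> K :=
  fun n => \sum_(0 <= j < n) a j * z ^+ j.

Definition power_sum (K : numFieldType) (a : nat -> K) (z : K) : K :=
  limn (power_sums a z).

(* tau(J_t^n) *)
Definition jacobi_coef (R : realType) (A : tracialNCPS R) (P : A) (U : R -> A)
    (t : R) (n : nat) : R[i] :=
  nc_tau A (compressed_pow P (compressed_jacobi P (U t)) n).

Definition mgf (R : realType) (A : tracialNCPS R) (k : nat) (P : A)
    (U : R -> A) (t : R) (z : R[i]) : R[i] :=
  k%:R * power_sum (jacobi_coef P U t) z.

(* m_n(oo), for the state k tau on PAP *)
Definition moment_infty (R : realType) (A : tracialNCPS R) (k : nat)
    (P Uinf : A) (n : nat) : R[i] :=
  k%:R * nc_tau A (compressed_pow P (compressed_jacobi P Uinf) n).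

Definition mgf_infty (R : realType) (A : tracialNCPS R) (k : nat)
    (P Uinf : A) (z : R[i]) : R[i] :=
  power_sum (moment_infty k P Uinf) z.

Definition rho_coef (R : realType) (A : tracialNCPS R) (k : nat) (P : A)
    (U : R -> A) (t : R) (n : nat) : R[i] :=
  if n is 0 then 0 else
  nc_tau A ((proj_T k P * U t * proj_T k P * vn_star (U t)) ^+ n)
    / (k%:R - 1) ^+ n.

Definition rho (R : realType) (A : tracialNCPS R) (k : nat) (P : A)
    (U : R -> A) (t : R) (z : R[i]) : R[i] :=
  power_sum (rho_coef k P U t) z.

(* sqrtc is the principal square root; alpha is meant on C \ [1, oo[. *)
Definition alpha (R : realType) (z : R[i]) : R[i] :=
  (1 - sqrtc (1 - z)) / (1 + sqrtc (1 - z)).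

(* Main.v *)
(* Put Q = U P U* and T = k P - 1, S = U T U* = k Q - 1.  In the algebra        *)
(* generated by two projections P, Q, the element Z = 1 - (P - Q)^2 is central  *)
(* with Z P = P Q P, and V = T S / (k - 1) satisfies V + V^-1 = kap Z - 2 where *)
(* kap = k^2 / (k - 1).  Hence tau(V^n) is, up to the explicit term             *)
(* (1 - 2 / k) / (k - 1)^n, the value of tau(P .) on the Dickson polynomial     *)
(* D_n(kap Z - 2), D_n(y + 1/y) = y^n + 1/y^n.  If z = kap al / (1 + al)^2, the *)
(* Poisson kernel identity                                                      *)
(*   1 + sum_(n >= 1) D_n(kap x - 2) al^n = (1 - al) / (1 + al) / (1 - x z)     *)
(* turns the generating series of tau(V^n) into that of tau(J^n); here          *)
(* al = alpha(4 z / kap) and (1 - al) / (1 + al) = sqrt(1 - 4 z / kap).  For    *)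
(* the free Haar unitary tau(V^n) = 0 by freeness, which gives M_(oo, k), and   *)
(* the theorem follows by subtraction.                                          *)
Require Import Defs.
From HB Require Import structures.
From mathcomp Require Import all_boot all_order all_algebra.
From mathcomp Require Import ring lra zify.
Set Implicit Arguments.
Unset Strict Implicit.
Unset Printing Implicit Defensive.
Import Order.TTheory GRing.Theory Num.Theory numFieldNormedType.Exports.
Local Open Scope classical_set_scope.
Local Open Scope complex_scope.
Local Open Scope ring_scope.

(** The computation uses moments only, with no spectral measure. [proj_moment] at m is tau(Z^m P),
    which is tau(J^m) by [compressed_powE]; [dickson_moment] at m, n plays the part of tau(P Z^m
    D_n(kap Z - 2)). Its recurrence comes from W + W' = k^2 Z - 2 (k - 1) ([tau_WW']) and W W' = (k
    - 1)^2 ([mulWW']). Multiplying the Poisson series by 1 - x z becomes the relation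
    [transfer_step]; iterating it gives [dickson_transfer], for |z| < 1, under a bound K B^n uniform
    in m with |al| B < 1.

    That bound fixes the domain. For any unitary, 0 <= P Q P <= P bounds the moments and B = kap + 3
    works, hence a small disc. For the free Haar unitary tau(V^n) = 0 for n >= 1 and B = 1 works,
    hence the unit disc. [jacobi_mgf] serves both cases: with s = sqrt(1 - 4 z / kap), the
    generating function is k rho(al) / s plus a term independent of the unitary, and k / s is the
    stated prefactor. *)

(** * Convergence of complex sequences *)

Section ComplexSequences.
Variable R : realType.
(* [R[i]] carries its norm topology only when displayed as a numFieldType. *)
Local Notation C := (Num.NumField.sort (R[i] : numFieldType)).
Implicit Types (u : nat -> C) (q K z : C).

Lemma cvg_normC_squeeze u (e : nat -> R) :
  (forall n, `|u n| <= (e n)%:C) -> e @ \oo --> 0 -> u @ \oo --> 0.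
Proof.
move=> ue /cvgrPdist_le e0; apply/cvgrPdist_le => eps eps0.
have /complex_realP[r er] : eps \is Num.real by rewrite realE ltW.
have r0 : 0 < r by move: eps0; rewrite er ltcR.
apply: filterS (e0 _ r0) => n; rewrite !sub0r !normrN er => h.
apply: le_trans (ue n) _; rewrite lecR; exact: le_trans (ler_norm _) h.
Qed.

Lemma cvg_expC q : `|q| < 1 -> (fun n => q ^+ n) @ \oo --> 0.
Proof.
have /complex_realP[r er] := normr_real q => q1.
have r0 : 0 <= r by rewrite -lecR -er; exact: normr_ge0.
apply: (@cvg_normC_squeeze _ (fun n => r ^+ n)) => [n|].
  by rewrite normrX er rmorphXn lexx.
by apply: cvg_expr; rewrite ger0_norm// -ltcR -er.
Qed.

Lemma cvg_geometric_squeeze u K q : 0 <= q < 1 ->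
  (forall n, `|u n| <= K * q ^+ n) -> u @ \oo --> 0.
Proof.
move=> /andP[q0 q1] uK.
have /cvgrPdist_le c : (fun n => K * q ^+ n) @ \oo --> 0.
  rewrite -[X in _ --> X](mulr0 K); apply: cvgM; first exact: cvg_cst.
  by apply: cvg_expC; rewrite ger0_norm.
apply/cvgrPdist_le => eps eps0; apply: filterS (c _ eps0) => n.
rewrite !sub0r !normrN; apply: le_trans.
apply: le_trans (uK n) _; apply/real_ler_norm/ger0_real.
exact: le_trans (uK n).
Qed.

Lemma cvgn_ReIm u : cvgn (fun n => complex.Re (u n) : R^o) ->
  cvgn (fun n => complex.Im (u n) : R^o) -> cvgn u.
Proof.
move=> /cvg_ex[/= a /cvgrPdist_le ca] /cvg_ex[/= b /cvgrPdist_le cb].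
apply: (cvgP (a +i* b : C)); apply/cvgrPdist_le => eps eps0.
have /complex_realP[r er] : eps \is Num.real by rewrite realE ltW.
have r0 : 0 < r / 2 by move: eps0; rewrite er ltcR => ?; rewrite divr_gt0.
near=> n.
have h1 : `|a - complex.Re (u n)| <= r / 2 by near: n; exact: ca.
have h2 : `|b - complex.Im (u n)| <= r / 2 by near: n; exact: cb.
have -> : (a +i* b) - u n =
    (a - complex.Re (u n))%:C + 'i%C * (b - complex.Im (u n))%:C.
  by case: (u n) => x y; simpc.
apply: le_trans (ler_normD _ _) _.
have nC (x : R) : `|x%:C| = `|x|%:C.
  by rewrite normc_def /= expr0n addr0 sqrtr_sqr.
have ni : `|'i%C : R[i]| = 1 by rewrite normc_def /= expr0n add0r expr1n sqrtr1.
rewrite normrM ni mul1r !nC -rmorphD /= er lecR; lra.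
Unshelve. all: by end_near.
Qed.

Lemma cvgn_geometric_increments u K q : 0 <= q < 1 ->
  (forall n, `|u n.+1 - u n| <= K * q ^+ n) -> cvgn u.
Proof.
move=> /andP[q0 q1] uK.
have /complex_realP[r er] : q \is Num.real by rewrite realE q0.
have K0 : 0 <= K by have:= uK 0%N; rewrite expr0 mulr1; apply: le_trans.
have /complex_realP[k ek] : K \is Num.real by rewrite realE K0.
have r01 : 0 <= r /\ r < 1 by split; rewrite -?lecR -?ltcR -er.
have k0 : 0 <= k by rewrite -lecR -ek.
have real_case (x : nat -> R^o) :
    (forall n, `|x n.+1 - x n| <= k * r ^+ n) -> cvgn x.
  move=> xk.
  have -> : x = (fun n => x 0%N + series (fun n => x n.+1 - x n) n).
    apply/funext => n; rewrite /series /= telescope_sumr//; by rewrite addrC subrK.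
  apply: is_cvgD; first exact: is_cvg_cst.
  apply: normed_cvg.
  apply: (@series_le_cvg _ _ (geometric k r)) => [n|n|n|].
  - exact: normr_ge0.
  - by rewrite /geometric /= mulr_ge0 ?exprn_ge0//; case: r01.
  - exact: xk.
  - by apply: is_cvg_geometric_series; rewrite ger0_norm; case: r01.
apply: cvgn_ReIm; apply: real_case => n; rewrite -lecR rmorphM rmorphXn /= -ek -er;
  apply: le_trans (uK n); case: (u n.+1) (u n) => [a b] [c d];
  rewrite normc_def /= lecR -sqrtr_sqr ler_sqrt ?addr_ge0 ?sqr_ge0//.
- by rewrite lerDl sqr_ge0.
- by rewrite lerDr sqr_ge0.
Qed.

Lemma cvg_geometricC q : `|q| < 1 ->
  (fun N => \sum_(0 <= n < N) q ^+ n.+1) @ \oo --> q / (1 - q).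
Proof.
move=> q1; have q_neq1 : 1 - q != 0.
  by rewrite subr_eq0; apply: contraTneq q1 => <-; rewrite normr1 ltxx.
have -> : (fun N => \sum_(0 <= n < N) q ^+ n.+1) =
    (fun N => q / (1 - q) * (1 - q ^+ N)).
  apply/funext; elim=> [|N IH]; first by rewrite big_geq// expr0 subrr mulr0.
  by rewrite big_nat_recr//= IH !exprS; field.
suff : (fun N => q / (1 - q) * (1 - q ^+ N)) @ \oo --> q / (1 - q) * (1 - 0).
  by rewrite subr0 mulr1.
by apply: cvgM; [exact: cvg_cst|apply: cvgB; [exact: cvg_cst|exact: cvg_expC]].
Qed.

End ComplexSequences.

Lemma sum_geometric_le (F : numFieldType) (q : F) (N : nat) : 0 <= q < 1 ->
  \sum_(0 <= n < N) q ^+ n <= (1 - q)^-1.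
Proof.
move=> /andP[q0 q1]; have q1' : 0 < 1 - q by rewrite subr_gt0.
have E : (1 - q) * (\sum_(0 <= n < N) q ^+ n) = 1 - q ^+ N.
  elim: N => [|N IH]; first by rewrite big_geq// mulr0 expr0 subrr.
  by rewrite big_nat_recr//= mulrDr IH exprS; ring.
by rewrite -[leRHS]mul1r ler_pdivlMr// mulrC E lerBlDr lerDl exprn_ge0.
Qed.

(** * From Dickson moments to the moment series *)

(* If [a] are the moments of a linear functional L on polynomials in x, then    *)
(* [d m n] stands for L(x^m D_n(kap x - 2)), D_n(y + 1/y) = y^n + 1/y^n being   *)
(* the Dickson polynomials; the hypotheses are D_0 = 2, D_1 = c and             *)
(* D_(n+2) = c D_(n+1) - D_n for c = kap x - 2.                                 *)
Section DicksonTransfer.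
Variable R : realType.
Local Notation C := (Num.NumField.sort (R[i] : numFieldType)).
Variables (a : nat -> C) (d : nat -> nat -> C) (kap al z K B : C).
Hypothesis d0 : forall m, d m 0%N = 2 * a m.
Hypothesis d1 : forall m, d m 1%N = kap * a m.+1 - 2 * a m.
Hypothesis dS : forall m n,
  kap * d m.+1 n.+1 = d m n.+2 + 2 * d m n.+1 + d m n.
Hypothesis B_ge0 : 0 <= B.
Hypothesis d_le : forall m n, `|d m n| <= K * B ^+ n.
Hypothesis alB_lt1 : `|al| * B < 1.
Hypothesis z_lt1 : `|z| < 1.
Hypothesis al_neq : 1 + al != 0.
Hypothesis al_neq1 : 1 - al != 0.
Hypothesis z_al : (1 + al) ^+ 2 * z = kap * al.

Let g m N := a m + \sum_(0 <= n < N) d m n.+1 * al ^+ n.+1.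
Let r m N := (d m N * al ^+ N.+2 - d m N.+1 * al ^+ N.+1) / (1 + al) ^+ 2.
Let s := (1 - al) / (1 + al).
Let q := `|al| * B.

(** With c = kap x - 2 one has (1 + al)^2 (1 - x z) = 1 - c al + al^2, which telescopes the
    truncated Poisson series [g]; [r] collects the boundary terms left at order N. *)
Lemma transfer_step m N : g m N = z * g m.+1 N + s * a m + r m N.
Proof.
have al2 : (1 + al) ^+ 2 != 0 by rewrite expf_neq0.
have E : (1 + al) ^+ 2 * g m N = kap * al * g m.+1 N + (1 - al ^+ 2) * a m
    + (d m N * al ^+ N.+2 - d m N.+1 * al ^+ N.+1).
  rewrite /g; elim: N => [|N IH].
    by rewrite !big_geq// d0 d1 !addr0; ring.
  rewrite !big_nat_recr//= addrA mulrDr IH.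
  have -> : d m N.+2 = kap * d m.+1 N.+1 - 2 * d m N.+1 - d m N.
    by rewrite dS; ring.
  by rewrite !exprS; ring.
apply: (mulfI al2); rewrite E -z_al /s /r; field; exact: al_neq.
Qed.

Lemma transfer_iter M N : g 0%N N =
  s * power_sums a z M + z ^+ M * g M N + \sum_(0 <= m < M) z ^+ m * r m N.
Proof.
rewrite /power_sums; elim: M => [|M IH]; first by rewrite !big_geq//; ring.
by rewrite IH !big_nat_recr//= {1}transfer_step exprS; ring.
Qed.

Let K_ge0 : 0 <= K.
Proof. by have := d_le 0 0; rewrite expr0 mulr1; apply: le_trans. Qed.

Let q_01 : 0 <= q < 1.
Proof. by rewrite alB_lt1 mulr_ge0. Qed.

Let term_le m n j : `|d m n * al ^+ (n + j)| <= K * q ^+ n * `|al| ^+ j.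
Proof.
rewrite normrM normrX exprD mulrA /q exprMn ler_wpM2r// ?exprn_ge0//.
by rewrite [_ * B ^+ n]mulrC mulrA ler_wpM2r// exprn_ge0.
Qed.

Let g_le m N : `|g m N| <= K + K / (1 - q).
Proof.
have [q0 q1] := andP q_01.
apply: le_trans (ler_normD _ _) _; apply: lerD.
  have := d_le m 0; rewrite d0 expr0 mulr1 normrM normr_nat; apply: le_trans.
  by rewrite ler_peMl// ler1n.
apply: le_trans (ler_norm_sum _ _ _) _.
apply: (@le_trans _ _ (\sum_(0 <= n < N) K * q ^+ n)).
  apply: ler_sum => n _; have := term_le m n.+1 0; rewrite addn0 => /le_trans.
  by apply; rewrite expr0 mulr1 exprS ler_wpM2l// ler_piMl ?exprn_ge0// ltW.
by rewrite -mulr_sumr ler_wpM2l// sum_geometric_le.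
Qed.

Let r_le m N : `|r m N| <= (K * `|al| ^+ 2 + K * q) / `|1 + al| ^+ 2 * q ^+ N.
Proof.
rewrite /r normrM normfV normrX mulrAC ler_wpM2r// ?invr_ge0 ?exprn_ge0//.
apply: le_trans (ler_normB _ _) _; rewrite mulrDl; apply: lerD.
  by rewrite -[N.+2]addn2 mulrAC term_le.
by have := term_le m N.+1 0; rewrite addn0 expr0 mulr1 [q ^+ _]exprS mulrA.
Qed.

Lemma dickson_transfer : exists h : C,
  ((fun N => \sum_(0 <= n < N) d 0%N n.+1 * al ^+ n.+1) @ \oo --> h) /\
  (power_sums a z @ \oo --> (a 0%N + h) / ((1 - al) / (1 + al))).
Proof.
have [q0 q1] := andP q_01.
have z01 : 0 <= `|z| < 1 by rewrite normr_ge0.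
have /cvg_ex[/= h hh] : cvgn (fun N => \sum_(0 <= n < N) d 0%N n.+1 * al ^+ n.+1).
  apply: (@cvgn_geometric_increments _ _ (K * q) q) => // n.
  rewrite big_nat_recr//= addrAC subrr add0r -mulrA -exprS.
  by have := term_le 0 n.+1 0; rewrite addn0 expr0 mulr1.
exists h; split; first exact: hh.
have s0 : s != 0 by rewrite mulf_neq0// invr_eq0.
(* Taking M = N in [transfer_iter] avoids a double limit: [g] is bounded uniformly in both indices
   and the boundary terms sum to O(q^N). *)
have -> : power_sums a z = (fun N => (g 0 N - z ^+ N * g N N
    - \sum_(0 <= m < N) z ^+ m * r m N) / s).
  by apply/funext => N; rewrite (transfer_iter N N); field.
apply: cvgM; last exact: cvg_cst.
rewrite -[a 0 + h]subr0 -[_ - 0]subr0.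
apply: cvgB; first apply: cvgB.
- by apply: cvgD; [exact: cvg_cst|exact: hh].
- apply: (@cvg_geometric_squeeze _ _ (K + K / (1 - q)) `|z|) => // n.
  by rewrite normrM normrX mulrC; apply: ler_wpM2r; [exact: exprn_ge0|exact: g_le].
- set K' := (K * `|al| ^+ 2 + K * q) / `|1 + al| ^+ 2.
  apply: (@cvg_geometric_squeeze _ _ (K' / (1 - `|z|)) q) => // n.
  apply: le_trans (ler_norm_sum _ _ _) _.
  apply: (@le_trans _ _ (\sum_(0 <= m < n) `|z| ^+ m * (K' * q ^+ n))).
    by apply: ler_sum => m _; rewrite normrM normrX; apply: ler_wpM2l; [exact: exprn_ge0|exact: r_le].
  rewrite -mulr_suml mulrC mulrAC; apply: ler_wpM2r; first exact: exprn_ge0.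
  apply: ler_wpM2l; last exact: sum_geometric_le.
  by have := r_le 0 0; rewrite expr0 mulr1; apply: le_trans.
Qed.

End DicksonTransfer.

(** * Trace identities for two projections of equal trace *)

Section TwoProjections.
Variables (F : numFieldType) (A : algType F) (tau : {scalar A}).
Hypothesis tau1 : tau 1 = 1.
Hypothesis tauC : forall a b, tau (a * b) = tau (b * a).
Variables (P Q : A) (k : F).
Hypothesis PP : P * P = P.
Hypothesis QQ : Q * Q = Q.
Hypothesis k_neq0 : k != 0.
Hypothesis k_neq1 : k - 1 != 0.
Hypothesis tauP : tau P = k^-1.
Hypothesis tauQ : tau Q = k^-1.

(* This is [1 - (P - Q) ^+ 2], which is central in the algebra generated by     *)
(* [P] and [Q].                                                                 *)
Definition proj_center : A := P * Q + Q * P - P - Q + 1.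
Local Notation Z := proj_center.

Definition proj_moment (m : nat) : F := tau (Z ^+ m * P).
Local Notation a := proj_moment.

Let W := (k *: P - 1) * (k *: Q - 1).
(* [W'] is [(k - 1) ^+ 2] times the inverse of [W].                             *)
Let W' := (k *: Q - (k - 1)%:A) * (k *: P - (k - 1)%:A).

(* [W / (k - 1)] has eigenvalues e^(+-i phi) on the generic part of the pair    *)
(* (P, Q); the subtracted term accounts for the eigenspaces P = Q = 0 and       *)
(* P = Q = 1, whose traces differ by [1 - 2 / k].                               *)
Definition dickson_moment (m n : nat) : F :=
  (tau (Z ^+ m * W ^+ n) - (1 - 2 / k)) / (k - 1) ^+ n.

Let tauD x y : tau (x + y) = tau x + tau y. Proof. exact: linearD. Qed.
Let tauN x : tau (- x) = - tau x. Proof. exact: linearN. Qed.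
Let tauZ c x : tau (c *: x) = c * tau x. Proof. exact: linearZ. Qed.

Lemma proj_centerP : Z * P = P * Q * P.
Proof.
rewrite /Z !mulrDl !mulNr mul1r PP -[Q * P * P]mulrA PP.
by rewrite [_ - Q * P]addrAC addrK subrK.
Qed.

Lemma commPZ : P * Z = Z * P.
Proof.
rewrite proj_centerP /Z !mulrDr !mulrN mulr1 !mulrA PP.
by rewrite [_ - P - _]addrAC subrK [P * Q + _]addrC addrK.
Qed.

Lemma proj_centerQ : Z * Q = Q * P * Q.
Proof.
rewrite /Z !mulrDl !mulNr mul1r QQ -[P * Q * Q]mulrA QQ.
by rewrite subrK [P * Q + _]addrC addrK.
Qed.

Lemma commQZ : Q * Z = Z * Q.
Proof.
rewrite proj_centerQ /Z !mulrDr !mulrN mulr1 !mulrA QQ.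
by rewrite subrK addrK.
Qed.

Lemma commPZX m : P * Z ^+ m = Z ^+ m * P.
Proof. exact/commrX/commPZ. Qed.

Lemma commQZX m : Q * Z ^+ m = Z ^+ m * Q.
Proof. exact/commrX/commQZ. Qed.

Lemma tau_ZPQ m : tau (Z ^+ m * (P * Q)) = a m.+1.
Proof.
rewrite /a exprSr -mulrA proj_centerP !mulrA [RHS]tauC !mulrA commPZX.
by rewrite -[_ * P * P]mulrA PP.
Qed.

Lemma tau_ZQP m : tau (Z ^+ m * (Q * P)) = a m.+1.
Proof. by rewrite -tau_ZPQ mulrA [LHS]tauC !mulrA commPZX. Qed.

(** For m > 0 one factor Z compresses to Q P Q and traciality exchanges P and Q; at m = 0 this is
    the equality of the two traces. *)
Lemma tau_ZQ m : tau (Z ^+ m * Q) = a m.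
Proof.
case: m => [|m]; first by rewrite /a !expr0 !mul1r tauP tauQ.
rewrite -tau_ZQP exprSr -mulrA proj_centerQ !mulrA [LHS]tauC !mulrA commQZX.
by rewrite -[_ * Q * Q]mulrA QQ.
Qed.

Lemma proj_moment0 : a 0 = k^-1.
Proof. by rewrite /a expr0 mul1r. Qed.

(** Expanding one factor Z shows that tau(Z^m) - 2 a m does not depend on m. *)
Lemma tau_Z m : tau (Z ^+ m) = 2 * a m + (1 - 2 / k).
Proof.
elim: m => [|m IH]; first by rewrite expr0 tau1 proj_moment0; ring.
rewrite exprSr {2}/Z !mulrDr !mulrN mulr1 !(tauD, tauN) IH.
by rewrite tau_ZPQ tau_ZQP tau_ZQ -/(a m); ring.
Qed.

Lemma dickson_moment0 m : dickson_moment m 0 = 2 * a m.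
Proof. by rewrite /dickson_moment expr0 mulr1 divr1 tau_Z addrK. Qed.

Lemma dickson_moment1 m :
  dickson_moment m 1 = k ^+ 2 / (k - 1) * a m.+1 - 2 * a m.
Proof.
have E : tau (Z ^+ m * W) = k ^+ 2 * a m.+1 - 2 * k * a m + tau (Z ^+ m).
  have -> : W = k ^+ 2 *: (P * Q) - k *: P - (k *: Q - 1).
    by rewrite /W mulrBl mulrBr mul1r mulr1 -scalerAl -scalerAr scalerA.
  rewrite !mulrBr mulr1 -!scalerAr !(tauD, tauN, tauZ) tau_ZPQ tau_ZQ -/(a m).
  ring.
by rewrite /dickson_moment !expr1 E tau_Z; field; exact/andP.
Qed.

Lemma tau_WW' x : tau (x * W) + tau (x * W') =
  k ^+ 2 * tau (x * Z) - 2 * (k - 1) * tau x.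
Proof.
have -> : W = k ^+ 2 *: (P * Q) - k *: P - (k *: Q - 1).
  by rewrite /W mulrBl mulrBr mul1r mulr1 -scalerAl -scalerAr scalerA.
have -> : W' = k ^+ 2 *: (Q * P) - (k * (k - 1)) *: Q
    - ((k - 1) * k *: P - ((k - 1) * (k - 1))%:A).
  rewrite /W' mulrBl (mulrBr (k *: Q)) (mulrBr (k - 1)%:A).
  by rewrite -!scalerAl -!scalerAr !mul1r !mulr1 !scalerA.
rewrite /Z !(mulrBr, mulrDr) !mulr1 -!scalerAr !mulr1.
by rewrite !(tauD, tauN, tauZ); ring.
Qed.

(** The inner pair of factors, in Q, collapses to the scalar k - 1, and then so does the pair in
    P. *)
Lemma mulWW' : W * W' = ((k - 1) ^+ 2)%:A.
Proof.
have E (p : A) : p * p = p ->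
    (k *: p - 1) * (k *: p - (k - 1)%:A) = (k - 1)%:A.
  move=> pp; rewrite !mulrBl !mulrBr !mul1r -!(scalerAl, scalerAr) pp mulr1.
  rewrite !scalerA opprB addrA addrAC -!scalerBl.
  have -> : k * k - k * (k - 1) - k = 0 by ring.
  by rewrite scale0r add0r.
rewrite /W /W' -mulrA [(k *: Q - 1) * _]mulrA E//.
by rewrite -scalerAl mul1r -scalerAr E// scalerA -expr2.
Qed.

(** The term subtracted in [dickson_moment] obeys the same recurrence, since y = 1 / (k - 1) solves
    kap y = y^2 + 2 y + 1. *)
Lemma dickson_momentS m n : k ^+ 2 / (k - 1) * dickson_moment m.+1 n.+1 =
  dickson_moment m n.+2 + 2 * dickson_moment m n.+1 + dickson_moment m n.
Proof.
have E1 : Z ^+ m * W ^+ n.+1 * W = Z ^+ m * W ^+ n.+2.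
  by rewrite -mulrA -exprSr.
have E2 : Z ^+ m * W ^+ n.+1 * W' = (k - 1) ^+ 2 *: (Z ^+ m * W ^+ n).
  by rewrite exprSr -(mulrA (Z ^+ m)) -(mulrA (W ^+ n)) mulWW' -!scalerAr mulr1.
have E3 : tau (Z ^+ m * W ^+ n.+1 * Z) = tau (Z ^+ m.+1 * W ^+ n.+1).
  by rewrite tauC mulrA -exprS.
have := tau_WW' (Z ^+ m * W ^+ n.+1); rewrite E1 E2 E3 tauZ => E.
rewrite /dickson_moment.
have -> : tau (Z ^+ m * W ^+ n.+2) = k ^+ 2 * tau (Z ^+ m.+1 * W ^+ n.+1)
    - (k - 1) ^+ 2 * tau (Z ^+ m * W ^+ n)
    - 2 * (k - 1) * tau (Z ^+ m * W ^+ n.+1).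
  by apply: (addIr ((k - 1) ^+ 2 * tau (Z ^+ m * W ^+ n))); rewrite E; ring.
by rewrite !exprS; field; rewrite k_neq0 k_neq1 expf_neq0.
Qed.

End TwoProjections.

(** * Bounds uniform in the power of Z *)

Section DicksonBounds.
Variables (F : numFieldType) (a : nat -> F) (d : nat -> nat -> F) (kap : F).
Hypothesis d0 : forall m, d m 0%N = 2 * a m.
Hypothesis d1 : forall m, d m 1%N = kap * a m.+1 - 2 * a m.
Hypothesis dS : forall m n,
  kap * d m.+1 n.+1 = d m n.+2 + 2 * d m n.+1 + d m n.

(** The recurrence gives kap times an entry of row m + 1 from entries of row m with weights 1, 2, 1
    (reading D_(-1) as D_1 when n = 0), so kap >= 4 propagates the bound. *)
Lemma dickson_le1 : 4 <= kap -> (forall n, `|d 0%N n| <= 1) ->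
  forall m n, `|d m n| <= 1.
Proof.
move=> kap4 b0; have kap0 : 0 < kap by apply: lt_le_trans kap4; rewrite ltr0n.
elim=> [//|m IH n].
suff E : `|kap * d m.+1 n| <= 4.
  move: E; rewrite normrM gtr0_norm// => E.
  by rewrite -(ler_pM2l kap0) mulr1 (le_trans E).
have dn (x : F) : `|2 * x| = 2 * `|x| by rewrite normrM normr_nat.
have -> : 4 = 1 + 2 * 1 + 1 :> F by ring.
case: n => [|n]; last first.
  rewrite dS; do 2![apply: le_trans (ler_normD _ _) _; apply: lerD => //].
  by rewrite dn ler_pM2l.
have -> : kap * d m.+1 0 = d m 1 + 2 * d m 0 + d m 1 by rewrite !d0 d1; ring.
do 2![apply: le_trans (ler_normD _ _) _; apply: lerD => //].
by rewrite dn ler_pM2l.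
Qed.

(** The base B = kap + 3 is chosen so that (kap + 2) B + 1 <= B^2. *)
Lemma dickson_le_exp : 0 <= kap -> (forall m, `|a m| <= 1) ->
  forall m n, `|d m n| <= 2 * (kap + 3) ^+ n.
Proof.
move=> kap0 a1 m n; have B1 : 1 <= kap + 3.
  have -> : kap + 3 = 1 + (kap + 2) by ring.
  by rewrite lerDl addr_ge0.
have B0 : 0 <= kap + 3 by exact: le_trans B1.
have dn (x : F) : `|2 * x| = 2 * `|x| by rewrite normrM normr_nat.
have b0 i : `|d i 0%N| <= 2 by rewrite d0 dn ler_piMr.
have b1 i : `|d i 1%N| <= 2 * (kap + 3).
  rewrite d1; apply: le_trans (ler_normB _ _) _; rewrite normrM ger0_norm// dn.
  apply: (@le_trans _ _ (kap * 1 + 2 * 1)).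
    by apply: lerD; apply: ler_wpM2l.
  have -> : 2 * (kap + 3) = kap * 1 + 2 * 1 + (kap + 4) by ring.
  by rewrite lerDl addr_ge0.
suff: `|d m n| <= 2 * (kap + 3) ^+ n /\ `|d m n.+1| <= 2 * (kap + 3) ^+ n.+1.
  by case.
elim: n m => [|n IH] m; first by rewrite expr0 mulr1 expr1.
have [h0 h1] := IH m; have [_ h2] := IH m.+1; split=> //.
have -> : d m n.+2 = kap * d m.+1 n.+1 - 2 * d m n.+1 - d m n.
  by rewrite dS; ring.
set B := kap + 3; have Bn : 0 <= B ^+ n by exact: exprn_ge0.
apply: (@le_trans _ _ (kap * (2 * B ^+ n.+1) + 2 * (2 * B ^+ n.+1) + 2 * B ^+ n)).
  do 2![apply: le_trans (ler_normB _ _) _; apply: lerD => //].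
    by rewrite normrM ger0_norm//; apply: ler_wpM2l.
  by rewrite dn; apply: ler_wpM2l.
have -> : 2 * B ^+ n.+2 = kap * (2 * B ^+ n.+1) + 2 * (2 * B ^+ n.+1)
    + 2 * B ^+ n + 2 * B ^+ n * (B - 1) by rewrite /B !exprS; ring.
by rewrite lerDl !mulr_ge0// subr_ge0.
Qed.

End DicksonBounds.

(** * Laws of the involution *)

Section Involution.
Variables (R : realType) (A : vonNeumannAlgebra R).
Implicit Types a b : A.
Local Notation ip := (@vn_ip R A).

(** Adjoints are unique and [vn_rep] is injective; the laws below rest on this. *)
Lemma vn_starP a b :
  (forall h g, ip (vn_rep a h) g = ip h (vn_rep b g)) -> vn_star a = b.
Proof.
have [ipl ipC ipN] := vn_ipP A => H; apply: (@vn_rep_inj R A).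
apply/funext => g; set x := vn_rep _ g; set y := vn_rep b g.
have E h : ip (x - y) h = 0.
  have -> : x - y = (-1) *: y + x by rewrite scaleN1r addrC.
  by rewrite ipl mulN1r ipC -H (ipC h x) -vn_rep_star addNr.
apply/eqP; rewrite -subr_eq0 -normr_eq0 -sqrf_eq0.
by apply/eqP; rewrite -ipN E.
Qed.

Lemma vn_star_lin c a b : vn_star (c *: a + b) = c^* *: vn_star a + vn_star b.
Proof.
have [ipl ipC ipN] := vn_ipP A; apply: vn_starP => h g.
rewrite !vn_rep_linear ipl !vn_rep_star [RHS]ipC ipl rmorphD rmorphM/=.
by rewrite conjCK -!ipC.
Qed.

Lemma vn_starM a b : vn_star (a * b) = vn_star b * vn_star a.
Proof. by apply: vn_starP => h g; rewrite !vn_rep_mul !vn_rep_star. Qed.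

Lemma vn_star1 : vn_star (1 : A) = 1.
Proof. by apply: vn_starP => h g; rewrite !vn_rep_one. Qed.

Lemma vn_starK a : vn_star (vn_star a) = a.
Proof.
have [_ ipC _] := vn_ipP A.
by apply: vn_starP => h g; rewrite ipC -vn_rep_star -ipC.
Qed.

Lemma vn_starD a b : vn_star (a + b) = vn_star a + vn_star b.
Proof. by rewrite -[a]scale1r vn_star_lin rmorph1 !scale1r. Qed.

Lemma vn_starB a b : vn_star (a - b) = vn_star a - vn_star b.
Proof. by rewrite addrC -scaleN1r vn_star_lin rmorphN1 scaleN1r addrC. Qed.

End Involution.

(** * Positivity and monotonicity of the moments *)

Section SelfAdjointProjections.
Variables (R : realType) (A : tracialNCPS R) (P Q : A).
Hypothesis P_sa : vn_star P = P.
Hypothesis PP : P * P = P.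
Hypothesis Q_sa : vn_star Q = Q.
Hypothesis QQ : Q * Q = Q.

Local Notation Z := (proj_center P Q).
Let tau : {scalar A} := nc_tau A.
Local Notation a := (proj_moment tau P Q).

Let tau_pos (E y : A) : vn_star E = E -> E * E = E ->
  0 <= tau (vn_star y * E * y).
Proof.
move=> Es EE; have := nc_tau_pos (E * y).
by rewrite vn_starM Es !mulrA -[_ * E * E]mulrA EE.
Qed.

Let Z_sa : vn_star Z = Z.
Proof.
rewrite vn_starD !vn_starB vn_starD !vn_starM vn_star1 P_sa Q_sa.
by rewrite [Q * P + _]addrC.
Qed.

Let ZX_sa n : vn_star (Z ^+ n) = Z ^+ n.
Proof.
elim: n => [|n IH]; first by rewrite expr0 vn_star1.
by rewrite [in LHS]exprS vn_starM IH Z_sa exprSr.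
Qed.

Let compl_idem (E : A) : E * E = E -> (1 - E) * (1 - E) = 1 - E.
Proof. by move=> EE; rewrite mulrBl mul1r mulrBr mulr1 EE subrr subr0. Qed.

Let compl_sa (E : A) : vn_star E = E -> vn_star (1 - E) = 1 - E.
Proof. by move=> Es; rewrite vn_starB vn_star1 Es. Qed.

Let ZX_conj i j : Z ^+ j * (Z ^+ i * P) * Z ^+ j = Z ^+ (i + (j + j)) * P.
Proof.
rewrite -!mulrA (commPZX Q PP) !mulrA -!exprD.
by congr (Z ^+ _ * P); lia.
Qed.

Lemma proj_moment_even_ge0 j : 0 <= a (j + j).
Proof.
have := tau_pos (Z ^+ j) P_sa PP.
by rewrite ZX_sa -mulrA (commPZX Q PP) mulrA -exprD.
Qed.

(** With j the integer part of n / 2, the difference is tau(Z^j P (1 - Q) P Z^j) for even n and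
    tau(Z^j P Q (1 - P) Q P Z^j) for odd n. *)
Lemma proj_moment_decr n : a n.+1 <= a n.
Proof.
have tauB (x y : A) : tau x - tau y = tau (x - y) by rewrite raddfB.
rewrite -subr_ge0 /proj_moment tauB -(odd_double_half n) -addnn.
set j := n./2; rewrite -addSn -!ZX_conj -mulrBl -mulrBr.
have CP : P * (Q * P) = Z * P by rewrite proj_centerP// mulrA.
case: (odd n) => /=; rewrite ?expr0 ?mul1r ?expr1.
  have := tau_pos (Q * P * Z ^+ j) (compl_sa P_sa) (compl_idem PP).
  rewrite !(Q_sa, P_sa, ZX_sa, vn_starM); congr (0 <= tau _).
  rewrite !mulrA; congr (_ * _); rewrite -!mulrA; congr (_ * _).
  rewrite mulrBl mul1r !mulrBr [Q * (Q * P)]mulrA QQ CP; congr (_ - _).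
  by rewrite [Q * _]mulrA (commQZ P QQ) -(mulrA Z) (mulrA P Z)
    (commPZ Q PP) -(mulrA Z P) CP.
have := tau_pos (P * Z ^+ j) (compl_sa Q_sa) (compl_idem QQ).
rewrite vn_starM ZX_sa P_sa; congr (0 <= tau _).
rewrite !mulrA; congr (_ * _); rewrite -!mulrA; congr (_ * _).
by rewrite mulrBl mul1r mulrBr PP CP.
Qed.

(** An odd moment dominates the next even one, which is the trace of a positive element. *)
Lemma proj_moment_ge0 n : 0 <= a n.
Proof.
rewrite -(odd_double_half n) -addnn; case: (odd n) => /=.
  apply: le_trans (proj_moment_even_ge0 n./2.+1) _.
  by rewrite addSn addnS; exact: proj_moment_decr.
by rewrite add0n; exact: proj_moment_even_ge0.
Qed.

Lemma proj_moment_le n : `|a n| <= tau P.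
Proof.
rewrite ger0_norm ?proj_moment_ge0//.
elim: n => [|n IH]; last exact: le_trans (proj_moment_decr n) _.
by rewrite /proj_moment expr0 mul1r.
Qed.

End SelfAdjointProjections.

(** * The principal square root and the map [alpha] *)

Section Alpha.
Variable R : realType.
Local Notation C := (Num.NumField.sort (R[i] : numFieldType)).
Implicit Types w x : C.

Lemma Re_sqrtc_ge0 x : 0 <= complex.Re (sqrtc x).
Proof. by case: x => a b; rewrite /= sqrtr_ge0. Qed.

Lemma sqrtc_scale (c : R) x : 0 < c ->
  sqrtc (c%:C ^+ 2 * x) = c%:C * sqrtc x.
Proof.
move=> c0; case: x => a b.
have -> : c%:C ^+ 2 * (a +i* b) = (c ^+ 2 * a) +i* (c ^+ 2 * b).
  by rewrite -rmorphXn/=; simpc.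
have c2 : 0 < c ^+ 2 by rewrite exprn_gt0.
have -> : c%:C * sqrtc (a +i* b) =
    (c * complex.Re (sqrtc (a +i* b))) +i* (c * complex.Im (sqrtc (a +i* b))).
  by case: (sqrtc _) => p q; simpc.
have E : Num.sqrt ((c ^+ 2 * a) ^+ 2 + (c ^+ 2 * b) ^+ 2) =
    c ^+ 2 * Num.sqrt (a ^+ 2 + b ^+ 2).
  rewrite !(exprMn _ (c ^+ 2)) -mulrDr sqrtrM ?exprn_ge0 ?ltW// sqrtr_sqr.
  by rewrite gtr0_norm.
rewrite /sqrtc/= E -mulrDr -mulrBr -!(mulrA (c ^+ 2)) !(sqrtrM _ (ltW c2)) sqrtr_sqr.
rewrite (gtr0_norm c0) mulf_eq0 (gt_eqF c2)/=; congr (_ +i* _).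
by rewrite sgrM (gtr0_sg c2) mul1r mulrCA.
Qed.

Section AlphaSqrt.
Variable w : C.
Let s : C := sqrtc (1 - w).

Let s2 : s ^+ 2 = 1 - w. Proof. exact: sqr_sqrtc. Qed.

Lemma sqrtc_1B_neq0 : `|w| < 1 -> s != 0.
Proof.
rewrite sqrtc_eq0 subr_eq0; apply: contraTneq => <-.
by rewrite normr1 ltxx.
Qed.

Lemma norm_1Dsqrtc_ge1 : 1 <= `|1 + s|.
Proof.
apply: le_trans (normc_ge_Re _); rewrite -[1]/(1%:C) lecR.
apply: le_trans (ler_norm _); have := Re_sqrtc_ge0 (1 - w).
by rewrite -/s; case: s => a b /= ?; rewrite lerDl.
Qed.

Lemma add1_sqrtc_neq0 : 1 + s != 0.
Proof. by rewrite -normr_gt0 (lt_le_trans _ norm_1Dsqrtc_ge1). Qed.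

Lemma add1_alphaE : 1 + alpha w = 2 / (1 + s).
Proof. by rewrite /alpha -/s; field; exact: add1_sqrtc_neq0. Qed.

Lemma sub1_alphaE : 1 - alpha w = 2 * s / (1 + s).
Proof. by rewrite /alpha -/s; field; exact: add1_sqrtc_neq0. Qed.

Lemma alpha_ratioE : (1 - alpha w) / (1 + alpha w) = s.
Proof. by rewrite sub1_alphaE add1_alphaE; field; exact: add1_sqrtc_neq0. Qed.

Lemma alpha_mulE : alpha w * (1 + s) ^+ 2 = w.
Proof.
have -> : alpha w * (1 + s) ^+ 2 = 1 - s ^+ 2.
  by rewrite /alpha -/s; field; exact: add1_sqrtc_neq0.
by rewrite s2; ring.
Qed.

Lemma norm_alpha_le : `|alpha w| <= `|w|.
Proof.
have := congr1 Num.norm alpha_mulE; rewrite normrM normrX => E.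
rewrite -[X in _ <= X]E ler_peMr// exprn_ege1//.
exact: norm_1Dsqrtc_ge1.
Qed.

End AlphaSqrt.
Section DiscScaling.
Variables (k : nat) (z : C).
Hypothesis k_ge2 : (2 <= k)%N.

Let km1_ge1 : 1 <= (k%:R : C) - 1.
Proof. by rewrite lerBrDr -[1 + 1]/(2%:R) ler_nat. Qed.

Lemma natr_kappa_ge4 : 4 <= (k%:R : C) ^+ 2 / (k%:R - 1).
Proof.
rewrite ler_pdivlMr ?(lt_le_trans _ km1_ge1)//.
rewrite -subr_ge0; have -> : k%:R ^+ 2 - 4 * (k%:R - 1) = (k%:R - 2) ^+ 2 :> C.
  by ring.
by rewrite exprn_ge0// subr_ge0 ler_nat.
Qed.

Lemma disc_scaling_le : `|4 * (k%:R - 1) * z / k%:R ^+ 2| <= `|z|.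
Proof.
have k0 : 0 < (k%:R : C) ^+ 2 by rewrite exprn_gt0// ltr0n (leq_trans _ k_ge2).
have -> : 4 * (k%:R - 1) * z / k%:R ^+ 2 =
    4 * (k%:R - 1) / k%:R ^+ 2 * z by rewrite mulrAC.
have km1 : 0 <= 4 * ((k%:R : C) - 1) by rewrite mulr_ge0// (le_trans _ km1_ge1).
rewrite normrM ger0_norm ?divr_ge0// ?(ltW k0)//.
rewrite ler_piMl// ler_pdivrMr// mul1r.
by rewrite -ler_pdivlMr ?natr_kappa_ge4// (lt_le_trans _ km1_ge1).
Qed.

Lemma alpha_pole_neq0 w : `|w| < 1 -> k%:R - 1 - alpha w != 0.
Proof.
move=> w1; rewrite subr_eq0; apply: contraTneq (le_lt_trans (norm_alpha_le w) w1).
by move=> <-; rewrite ger0_norm ?(le_trans _ km1_ge1)// le_gtF.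
Qed.

End DiscScaling.
End Alpha.

(** * Generating functions for a fixed unitary *)

Section CompressedJacobi.
Variables (R : realType) (A : tracialNCPS R) (k : nat) (P : A).
Variables (U : R -> A) (t : R).
Local Notation u := (U t).
Local Notation C := (Num.NumField.sort (R[i] : numFieldType)).
Hypothesis k_ge2 : (2 <= k)%N.
Hypothesis P_sa : vn_star P = P.
Hypothesis PP : P * P = P.
Hypothesis tauP : nc_tau A P = k%:R^-1.
Hypothesis u_unitary : vn_unitary u.

Local Notation Q := (u * P * vn_star u).
Local Notation kC := (k%:R : C).
Let tau : {scalar A} := nc_tau A.
Let a : nat -> C := proj_moment tau P Q.
Let d : nat -> nat -> C := dickson_moment tau P Q k%:R.
Local Notation jac := (jacobi_coef P U t).
Local Notation rc := (rho_coef k P U t).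
Let kap : C := kC ^+ 2 / (kC - 1).

Let Q_sa : vn_star Q = Q.
Proof. by rewrite !vn_starM vn_starK P_sa mulrA. Qed.

Let QQ : Q * Q = Q.
Proof.
have [uu _] := u_unitary.
by rewrite !mulrA -[_ * vn_star u * u]mulrA uu mulr1 -[_ * P * P]mulrA PP.
Qed.

Let tauC x y : tau (x * y) = tau (y * x). Proof. exact: nc_tau_trace. Qed.

Let tauQ : tau Q = k%:R^-1.
Proof. by have [uu _] := u_unitary; rewrite -tauP tauC mulrA uu mul1r. Qed.

Let k_neq0 : kC != 0.
Proof. by rewrite pnatr_eq0 -lt0n (leq_trans _ k_ge2). Qed.

Let k_neq1 : kC - 1 != 0.
Proof. by rewrite subr_eq0 pnatr_eq1 gtn_eqF. Qed.

Let km1_ge1 : 1 <= kC - 1.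
Proof. by rewrite lerBrDr -[1 + 1]/(2%:R) ler_nat. Qed.

Let kap_ge4 : 4 <= kap.
Proof. exact: natr_kappa_ge4. Qed.

Let d0 m : d m 0 = 2 * a m.
Proof. exact: (dickson_moment0 (nc_tau_one A) tauC PP QQ tauP tauQ). Qed.

Let d1 m : d m 1 = kap * a m.+1 - 2 * a m.
Proof.
exact: (dickson_moment1 (nc_tau_one A) tauC PP QQ k_neq0 k_neq1 tauP tauQ).
Qed.

Let dS m n : kap * d m.+1 n.+1 = d m n.+2 + 2 * d m n.+1 + d m n.
Proof. exact: (dickson_momentS tauC PP QQ k_neq0 k_neq1). Qed.

Lemma compressed_powE n :
  compressed_pow P (compressed_jacobi P u) n = proj_center P Q ^+ n * P.
Proof.
set Z := proj_center P Q; rewrite /compressed_pow; elim: n => [|n IH]; first by rewrite mul1r.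
rewrite iterS IH.
have -> : compressed_jacobi P u = Z * P.
  by rewrite proj_centerP// /compressed_jacobi !mulrA.
by rewrite -(mulrA Z P) (mulrA P _ P) (commPZX Q PP) -(mulrA _ P P) PP mulrA -exprS.
Qed.

Lemma jacobi_momentE : jac = a.
Proof. by apply/funext => n; rewrite /jacobi_coef compressed_powE. Qed.

Lemma proj_T_prodE : proj_T k P * u * proj_T k P * vn_star u =
  (k%:R *: P - 1) * (k%:R *: Q - 1).
Proof.
have [_ uu] := u_unitary.
have -> : proj_T k P = k%:R *: P - 1 by rewrite /proj_T mulr_natl scaler_nat.
rewrite -!mulrA; congr (_ * _).
by rewrite mulrBl mulrBr mul1r uu -scalerAl -scalerAr mulrA.
Qed.

Lemma rho_coefE n : rc n.+1 = d 0 n.+1 + (1 - 2 / kC) / (kC - 1) ^+ n.+1.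
Proof.
by rewrite /rho_coef proj_T_prodE /d /dickson_moment expr0 mul1r -mulrDl subrK.
Qed.

Lemma dickson_moment_le m n : `|d m n| <= 2 * (kap + 3) ^+ n.
Proof.
apply: (dickson_le_exp d0 d1 dS (le_trans _ kap_ge4)) => // i.
apply: le_trans (proj_moment_le P_sa PP Q_sa QQ i) _.
by rewrite tauP invf_le1 ?ler1n ?ltr0n (leq_trans _ k_ge2).
Qed.

(** Row 0 is explicit here: 2 / k at n = 0 and -(1 - 2 / k) / (k - 1)^n afterwards; [dickson_le1]
    carries the bound to the other rows. *)
Lemma dickson_moment_free_le :
  (forall n, nc_tau A ((proj_T k P * u * proj_T k P * vn_star u) ^+ n.+1) = 0) ->
  forall m n, `|d m n| <= 1.
Proof.
move=> free; apply: (dickson_le1 d0 d1 dS kap_ge4) => n.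
have k2 : 2 / kC <= 1.
  by rewrite ler_pdivrMr ?mul1r ?ler_nat// ltr0n (leq_trans _ k_ge2).
case: n => [|n].
  by rewrite d0 /a (proj_moment0 Q tauP) ger0_norm// divr_ge0.
have -> : d 0 n.+1 = - ((1 - 2 / kC) / (kC - 1) ^+ n.+1).
  by apply/eqP; rewrite -addr_eq0 -rho_coefE /rho_coef free mul0r.
have kn : 1 <= (kC - 1) ^+ n.+1 by rewrite exprn_ege1.
rewrite normrN ger0_norm ?divr_ge0 ?subr_ge0// ?(le_trans _ kn)//.
by rewrite ler_pdivrMr ?(lt_le_trans _ kn)// mul1r (le_trans _ kn)//.
Qed.

(** The subtracted fraction sums the geometric terms by which the coefficients of [rho] exceed the
    Dickson moments. *)
Lemma jacobi_mgf (K B z : C) :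
  let w := 4 * (kC - 1) * z / kC ^+ 2 in
  0 <= B -> (forall m n, `|d m n| <= K * B ^+ n) ->
  `|z| < 1 -> `|z| * B < 1 ->
  cvgn (power_sums rc (alpha w)) /\
  power_sums jac z @ \oo -->
    ((kC^-1 + rho k P U t (alpha w)
       - (1 - 2 / kC) * (alpha w / (kC - 1 - alpha w))) / sqrtc (1 - w) : C).
Proof.
move=> w B0 dB z1 zB.
have kap0 : 0 < kap by apply: lt_le_trans kap_ge4.
have wz : `|w| <= `|z| by exact: disc_scaling_le.
have w1 : `|w| < 1 by exact: le_lt_trans wz z1.
set al := alpha w; have alz : `|al| <= `|z|.
  exact: le_trans (norm_alpha_le w) wz.
have s1 := add1_sqrtc_neq0 w; have s0 := sqrtc_1B_neq0 w1.
have al1 : 1 + al != 0 by rewrite /al add1_alphaE mulf_neq0// invr_eq0.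
have al1' : 1 - al != 0 by rewrite /al sub1_alphaE !mulf_neq0// invr_eq0.
have zal : (1 + al) ^+ 2 * z = kap * al.
  have -> : z = kap / 4 * w by rewrite /w /kap; field; rewrite k_neq0 k_neq1.
  rewrite -[in LHS](alpha_mulE w) -/al {1}/al add1_alphaE; field; exact: s1.
have [h [ch ca]] := dickson_transfer d0 d1 dS B0 dB
  (le_lt_trans (ler_wpM2r B0 alz) zB) z1 al1 al1' zal.
have alk : `|al / (kC - 1)| < 1.
  rewrite normrM normfV [X in _ / X]ger0_norm ?(le_trans _ km1_ge1)//.
  rewrite ltr_pdivrMr ?(lt_le_trans _ km1_ge1)// mul1r.
  by rewrite (le_lt_trans alz)// (lt_le_trans z1).
have alk' : kC - 1 - al != 0 by exact: alpha_pole_neq0.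
pose geo := al / (kC - 1 - al).
have crc : power_sums rc al @ \oo --> h + (1 - 2 / kC) * geo.
  have E n : rc n.+1 * al ^+ n.+1 = d 0 n.+1 * al ^+ n.+1 +
      (1 - 2 / kC) * (al / (kC - 1)) ^+ n.+1.
    rewrite rho_coefE (expr_div_n al (kC - 1)) (mulrDl (d 0 n.+1)).
    by rewrite (mulrAC (1 - 2 / kC)) (mulrA (1 - 2 / kC)).
  rewrite -(cvg_shiftS (power_sums rc al)).
  have -> : [sequence power_sums rc al n.+1]_n = (fun N =>
      \sum_(0 <= n < N) d 0 n.+1 * al ^+ n.+1 +
      (1 - 2 / kC) * \sum_(0 <= n < N) (al / (kC - 1)) ^+ n.+1).
    apply/funext => N; rewrite [LHS]/(power_sums rc al N.+1) /power_sums big_nat_recl// [rc 0 * _]mul0r add0r.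
    rewrite mulr_sumr -big_split; apply: eq_bigr => n _; exact: E.
  apply: cvgD; first exact: ch.
  apply: cvgM; first exact: cvg_cst.
  have -> : geo = al / (kC - 1) / (1 - al / (kC - 1)).
    by rewrite /geo; field; rewrite k_neq1 alk'.
  exact: cvg_geometricC.
split; first exact: cvgP crc.
have -> : rho k P U t al = h + (1 - 2 / kC) * geo.
  by apply: cvg_lim crc; exact: norm_hausdorff.
rewrite jacobi_momentE -/geo addrA addrK.
have a0 : a 0 = kC^-1 by exact: (proj_moment0 Q tauP).
by move: ca; rewrite alpha_ratioE a0.
Qed.

End CompressedJacobi.

(** * Vanishing of the Haar coefficients *)

Section FreeHaar.
Variables (R : realType) (A : tracialNCPS R) (k : nat) (P u : A).
Hypothesis k_gt0 : (0 < k)%N.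
Hypothesis tauP : nc_tau A P = k%:R^-1.
Hypothesis u_haar : haar_unitary u.
Hypothesis Pu_free : free_pair [set P] [set u; vn_star u].

(** The power is an alternating word in centered letters, as tau(T) = k / k - 1 = 0. *)
Lemma tau_proj_T_free n :
  nc_tau A ((proj_T k P * u * proj_T k P * vn_star u) ^+ n.+1) = 0.
Proof.
set T := proj_T k P.
pose letter j := match (j %% 4)%N with 1 => u | 3 => vn_star u | _ => T end.
have prodE m : \prod_(0 <= j < m * 4) letter j = (T * u * T * vn_star u) ^+ m.
  elim: m => [|m IH]; first by rewrite big_geq.
  have -> : (m.+1 * 4 = (m * 4).+4)%N by lia.
  rewrite !big_nat_recr//= IH exprSr; have -> : letter (m * 4)%N = T.
    by rewrite /letter modnMl.
  have letterS r : letter (m * 4 + r)%N = letter r by rewrite /letter modnMDl.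
  by rewrite -[(m * 4).+3]addn3 -[(m * 4).+2]addn2 -[(m * 4).+1]addn1 !letterS !mulrA.
rewrite -prodE; apply: (Pu_free (i := fun j => ~~ odd j)) => // [j _|j _].
  have T_alg : star_alg [set P] T.
    rewrite /T /proj_T mulr_natl -scaler_nat -scaleN1r.
    by apply: star_alg_add; apply: star_alg_scale;
      [exact: star_alg_in|exact: star_alg_one].
  have tauT : nc_tau A T = 0.
    rewrite /T /proj_T mulr_natl raddfB raddfMn/= tauP nc_tau_one.
    by rewrite -[_ *+ k]mulr_natr mulVf ?subrr// pnatr_eq0 -lt0n.
  have [_ /(_ 1%N isT)] := u_haar; rewrite !expr1 => -[tu tus].
  rewrite /letter -(@odd_mod j 4)//.
  have : (j %% 4 < 4)%N by rewrite ltn_pmod.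
  case: (j %% 4)%N => [|[|[|[|//]]]] _ /=; split=> //.
    by apply: star_alg_in; left.
  by apply: star_alg_in; right.
by rewrite /=; case: (odd j).
Qed.

End FreeHaar.

(** * Closed form at infinity and conclusion *)

(** The left side reduces to 2 (k - 1) / (k - 2 + k s), rationalised by (k s)^2 - (k - 2)^2 = 4 (k -
    1) (1 - z). *)
Lemma haar_mgf_closed_form (F : numFieldType) (k s z : F) :
  k != 0 -> 1 + s != 0 -> s != 0 -> 1 - z != 0 -> k - 2 + k * s != 0 ->
  4 * (k - 1) * z = k ^+ 2 * (1 - s ^+ 2) ->
  k * ((k^-1 - (1 - 2 / k) * ((1 - s) / (1 + s) / (k - 1 - (1 - s) / (1 + s))))
    / s) = (2 - k + k * s) / (2 * (1 - z)).
Proof.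
move=> k0 s1 s0 z1 D0 zE.
have -> : (1 - s) / (1 + s) / (k - 1 - (1 - s) / (1 + s)) =
    (1 - s) / (k - 2 + k * s).
  have -> : k - 1 - (1 - s) / (1 + s) = (k - 2 + k * s) / (1 + s) by field.
  by field; rewrite D0 s1.
have -> : k * ((k^-1 - (1 - 2 / k) * ((1 - s) / (k - 2 + k * s))) / s) =
    2 * (k - 1) / (k - 2 + k * s) by field; rewrite D0 k0 s0.
apply/eqP; rewrite eqr_div ?mulf_neq0//; apply/eqP.
have -> : 2 * (k - 1) * (2 * (1 - z)) = 4 * (k - 1) - 4 * (k - 1) * z by ring.
by rewrite zE; ring.
Qed.

Theorem corollary2 (R : realType) (A : tracialNCPS R) (k : nat) (P : A)
    (U : R -> A) (Uinf : A)
    (hk : (2 <= k)%N)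
    (hPsa : vn_star P = P) (hPproj : P * P = P)
    (hPtau : nc_tau A P = k%:R^-1)
    (hU : free_unitary_BM U)
    (hPU : free_pair [set P]
             [set a | exists2 t, 0 <= t & a = U t \/ a = vn_star (U t)])
    (hUinf : haar_unitary Uinf)
    (hPUinf : free_pair [set P] [set Uinf; vn_star Uinf]) :
  (forall z : R[i], `|z| < 1 ->
     cvgn (power_sums (moment_infty k P Uinf) z) /\
     mgf_infty k P Uinf z =
       (2 - k%:R + sqrtc (k%:R ^+ 2 - 4 * (k%:R - 1) * z)) / (2 * (1 - z))) /\
  (forall t : R, 0 < t ->
     exists2 r : R, 0 < r & forall z : R[i], `|z| < r%:C ->
       [/\ cvgn (power_sums (jacobi_coef P U t) z),
           cvgn (power_sums (rho_coef k P U t)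
                   (alpha (4 * (k%:R - 1) * z / k%:R ^+ 2))) &
           mgf k P U t z =
             mgf_infty k P Uinf z +
             k%:R ^+ 2 / sqrtc (k%:R ^+ 2 - 4 * (k%:R - 1) * z) *
               rho k P U t (alpha (4 * (k%:R - 1) * z / k%:R ^+ 2))]).
Proof.
pose C := Num.NumField.sort (R[i] : numFieldType).
have k0 : (k%:R : C) != 0 by rewrite pnatr_eq0 -lt0n (leq_trans _ hk).
have k1 : (k%:R - 1 : C) != 0 by rewrite subr_eq0 pnatr_eq1 gtn_eqF.
have limE (f : nat -> C) l : f @ \oo --> l -> limn f = l.
  by apply: cvg_lim; exact: norm_hausdorff.
have sqrtE (z : C) : sqrtc (k%:R ^+ 2 - 4 * (k%:R - 1) * z) =
    k%:R * sqrtc (1 - 4 * (k%:R - 1) * z / k%:R ^+ 2) :> C.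
  have kp : 0 < (k%:R : R) by rewrite ltr0n (leq_trans _ hk).
  have := sqrtc_scale (1 - 4 * (k%:R - 1) * z / k%:R ^+ 2) kp.
  rewrite rmorph_nat => <-; congr sqrtc; field; exact: k0.
pose w (z : C) : C := 4 * (k%:R - 1) * z / k%:R ^+ 2.
pose G (z : C) : C := (k%:R^-1 - (1 - 2 / k%:R) *
  (alpha (w z) / (k%:R - 1 - alpha (w z)))) / sqrtc (1 - w z).
have inf_cvg (z : C) : `|z| < 1 ->
    power_sums (moment_infty k P Uinf) z @ \oo --> (k%:R * G z : C).
  move=> z1; have [uU _] := hUinf.
  have free := tau_proj_T_free (ltnW hk) hPtau hUinf hPUinf.
  (* The constant process [cst Uinf], taken at time 0, brings [Uinf] under the lemmas stated for
     processes. *)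
  have dB m n : `|dickson_moment (nc_tau A) P (Uinf * P * vn_star Uinf)
      (k%:R : C) m n| <= 1 * 1 ^+ n.
    by rewrite mul1r expr1n; exact: (@dickson_moment_free_le _ _ _ _ (cst Uinf) 0).
  have zB : `|z| * 1 < 1 by rewrite mulr1.
  have [_] := @jacobi_mgf _ _ _ _ (cst Uinf) 0 hk hPproj hPtau uU _ _ _ ler01 dB z1 zB.
  have -> : rho k P (cst Uinf) 0 (alpha (w z)) = 0.
    apply: limE.
    have -> : power_sums (rho_coef k P (cst Uinf) 0) (alpha (w z)) = cst 0.
      apply/funext => N; apply: big1 => -[|n] _; rewrite /rho_coef ?mul0r//.
      by rewrite free !mul0r.
    exact: cvg_cst.
  rewrite addr0 => cJ.
  have -> : power_sums (moment_infty k P Uinf) z = (fun N => k%:R *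
      power_sums (jacobi_coef P (cst Uinf) 0) z N).
    apply/funext => N; rewrite /power_sums mulr_sumr.
    by apply: eq_bigr => n _; rewrite mulrA.
  by apply: cvgM; [exact: cvg_cst|exact: cJ].
have mgfE (z : C) : `|z| < 1 -> mgf_infty k P Uinf z = k%:R * G z.
  by move=> z1; apply: limE; exact: inf_cvg.
split=> [z z1|t t0].
  split; first exact: cvgP (inf_cvg z z1).
  rewrite (mgfE z z1) sqrtE; apply: haar_mgf_closed_form => //.
  - exact: add1_sqrtc_neq0.
  - exact/sqrtc_1B_neq0/(le_lt_trans (disc_scaling_le z hk)).
  - by rewrite subr_eq0; apply: contraTneq z1 => <-; rewrite normr1 ltxx.
  (* With al the value of [alpha], k - 2 + k s = (k - 1 - al) (1 + s). *)
  - have w1 : `|w z| < 1 by exact: le_lt_trans (disc_scaling_le z hk) z1.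
    have s1 := add1_sqrtc_neq0 (w z).
    have := mulf_neq0 (alpha_pole_neq0 hk w1) s1; congr (_ != 0).
    by rewrite /alpha; field.
  - by rewrite sqr_sqrtc /w; field.
pose B : R := k%:R ^+ 2 / (k%:R - 1) + 3.
have BC : B%:C = k%:R ^+ 2 / (k%:R - 1) + 3 :> C.
  by rewrite rmorphD rmorphM fmorphV rmorphB rmorphXn !rmorph_nat.
have B1 : 1 <= B.
  have kR : 1 <= (k%:R : R) - 1 by rewrite lerBrDr -[1 + 1]/(2%:R) ler_nat.
  have : 0 <= (k%:R : R) ^+ 2 / (k%:R - 1).
    by rewrite divr_ge0 ?exprn_ge0// (le_trans _ kR).
  rewrite /B; lra.
have B0 : 0 < B by exact: lt_le_trans B1.
(* This radius gives |z| B < 1, and also |z| < 1 because B >= 1. *)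
exists B^-1; first by rewrite invr_gt0.
move=> z; rewrite fmorphV => zr; have [X [_ uU _ _ _]] := hU.
have BC0 : 0 < (B%:C : C) by rewrite ltcR.
have zB : `|z : C| * B%:C < 1 by rewrite -ltr_pdivlMr// mul1r.
have z1 : `|z : C| < 1.
  by apply: le_lt_trans zB; rewrite ler_peMr// lecR.
have uUt := uU t (ltW t0).
have dB m n := dickson_moment_le hk hPsa hPproj hPtau uUt m n.
rewrite -BC in dB.
have [crc cJ] := jacobi_mgf hk hPproj hPtau uUt (ltW BC0) dB z1 zB.
split; [exact: cvgP cJ|exact: crc|].
rewrite (mgfE z z1) sqrtE /mgf.
rewrite /power_sum (limE _ _ cJ).
rewrite -/(w z) /G; have w1 := le_lt_trans (disc_scaling_le z hk) z1.
move: (sqrtc_1B_neq0 w1) (alpha_pole_neq0 hk w1); rewrite -/(w z).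
move: (sqrtc _) (alpha _) (rho _ _ _ _ _) => s al rh s0 al0.
by field; rewrite k0 s0.
Qed.
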